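(* For every integer $n\geq 0$, \begin{align*} \overline{p}_{-5}(8n+1) &\equiv 0 \pmod{2}, & \overline{p}_{-5}(8n+2) &\equiv 0 \pmod{4}, & \overline{p}_{-5}(8n+3) &\equiv 0 \pmod{8}, \\ \overline{p}_{-5}(8n+4) &\equiv 0 \pmod{2}, & \overline{p}_{-5}(8n+5) &\equiv 0 \pmod{8}, & \overline{p}_{-5}(8n+6) &\equiv 0 \pmod{8}, \end{align*} and \[ \overline{p}_{-5}(8n+7) \equiv 0 \pmod{128}. \]
   Context: For $|q|<1$ let $(a;q)_\infty=\prod_{i\geq 0}(1-aq^i)$. For a positive integer $t$, the number $\overline{p}_{-t}(n)$ of $t$-colored overpartitions of $n$ is defined by the generating function \[ \sum_{n\geq 0}\overline{p}_{-t}(n)q^n=\frac{(q^2;q^2)_\infty^t}{(q;q)_\infty^{2t}}. \] *)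

(* Defs.v *)
From HB Require Import structures.
From mathcomp Require Import all_boot all_algebra.
From mathcomp Require Import boolp.

Set Implicit Arguments.
Unset Strict Implicit.
Unset Printing Implicit Defensive.

Import GRing.Theory.
Local Open Scope ring_scope.

(* Formal power series over R; f n is the coefficient of q^n.  The identities
   between convergent series for |q| < 1 are read in this ring, and "|q| < 1"
   for a series substituted for q becomes "zero constant coefficient". *)
Record fps (R : Type) := Fps { coefs :> nat -> R }.

Lemma fpsP (R : Type) (f g : fps R) : (forall n, f n = g n) -> f = g.
Proof. by case: f g => [f] [g] /= fg; congr Fps; apply/funext. Qed.

HB.instance Definition _ (R : Type) := gen_eqMixin (fps R).
HB.instance Definition _ (R : Type) := gen_choiceMixin (fps R).

Section Ring.
Variable R : comNzRingType.
Implicit Types f g h : fps R.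

Definition fps0 : fps R := Fps (fun=> 0).
Definition fps_opp f : fps R := Fps (fun n => - f n).
Definition fps_add f g : fps R := Fps (fun n => f n + g n).
Definition fps1 : fps R := Fps (fun n => (n == 0)%:R).
Definition fps_mul f g : fps R :=
  Fps (fun n => \sum_(i < n.+1) f i * g (n - i)%N).

Fact fps_addA : associative fps_add.
Proof. by move=> f g h; apply: fpsP => n /=; rewrite addrA. Qed.
Fact fps_addC : commutative fps_add.
Proof. by move=> f g; apply: fpsP => n /=; rewrite addrC. Qed.
Fact fps_add0 : left_id fps0 fps_add.
Proof. by move=> f; apply: fpsP => n /=; rewrite add0r. Qed.
Fact fps_addN : left_inverse fps0 fps_opp fps_add.
Proof. by move=> f; apply: fpsP => n /=; rewrite addNr. Qed.

HB.instance Definition _ :=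
  GRing.isZmodule.Build (fps R) fps_addA fps_addC fps_add0 fps_addN.

Definition fps_trunc (m : nat) f : {poly R} := \poly_(i < m.+1) f i.

Lemma fps_truncE m f i : (i <= m)%N -> (fps_trunc m f)`_i = f i.
Proof. by move=> im; rewrite coef_poly ltnS im. Qed.

Lemma fps_trunc_mul m f g i : (i <= m)%N ->
  (fps_trunc m f * fps_trunc m g)`_i = fps_mul f g i.
Proof.
move=> im; rewrite coefM; apply: eq_bigr => j _.
by rewrite !fps_truncE // (leq_trans _ im) // ?leq_subr // -ltnS.
Qed.

Fact fps_mulA : associative fps_mul.
Proof.
move=> f g h; apply: fpsP => n.
transitivity ((fps_trunc n f * (fps_trunc n g * fps_trunc n h))`_n).
  rewrite coefM; apply: eq_bigr => i _.
  by rewrite fps_truncE -1?ltnS // fps_trunc_mul // leq_subr.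
rewrite mulrA coefM; apply: eq_bigr => i _.
by rewrite fps_trunc_mul -1?ltnS // fps_truncE // leq_subr.
Qed.

Fact fps_mulC : commutative fps_mul.
Proof.
by move=> f g; apply: fpsP => n; rewrite -!(@fps_trunc_mul n) // mulrC.
Qed.

Fact fps_mul1 : left_id fps1 fps_mul.
Proof.
move=> f; apply: fpsP => n /=.
rewrite big_ord_recl /= mul1r subn0 big1 ?addr0 // => i _.
by rewrite mul0r.
Qed.

Fact fps_mulDl : left_distributive fps_mul fps_add.
Proof.
move=> f g h; apply: fpsP => n /=; rewrite -big_split /=.
by apply: eq_bigr => i _; rewrite mulrDl.
Qed.

Fact fps1_neq0 : fps1 != 0.
Proof.
apply/eqP => /(congr1 (fun f : fps R => f 0)) /= /eqP.
by rewrite oner_eq0.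
Qed.

HB.instance Definition _ := GRing.Zmodule_isComNzRing.Build (fps R)
  fps_mulA fps_mulC fps_mul1 fps_mulDl fps1_neq0.

Lemma fps_coef0 n : (0 : fps R) n = 0. Proof. by []. Qed.
Lemma fps_coef1 n : (1 : fps R) n = (n == 0)%:R. Proof. by []. Qed.
Lemma fps_coefN f n : (- f) n = - f n. Proof. by []. Qed.
Lemma fps_coefD f g n : (f + g) n = f n + g n. Proof. by []. Qed.
Lemma fps_coefM f g n : (f * g) n = \sum_(i < n.+1) f i * g (n - i)%N.
Proof. by []. Qed.
Lemma fps_coef_sum I (r : seq I) (P : pred I) (F : I -> fps R) n :
  (\sum_(i <- r | P i) F i) n = \sum_(i <- r | P i) F i n.
Proof. by elim/big_rec2: _ => // i x y _ <-. Qed.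

Lemma fps_coefM0 f g : (f * g) 0 = f 0 * g 0.
Proof. by rewrite fps_coefM big_ord_recl big_ord0 addr0 subn0. Qed.

Lemma fps_coefM_le f g1 g2 n :
  (forall i, (i <= n)%N -> g1 i = g2 i) -> (f * g1) n = (f * g2) n.
Proof.
by move=> g12; rewrite !fps_coefM; apply: eq_bigr => i _; rewrite g12 ?leq_subr.
Qed.

Lemma fps_coefX_lt f k n : f 0 = 0 -> (n < k)%N -> (f ^+ k) n = 0.
Proof.
move=> f0; elim: k n => // k IHk n nk; rewrite exprS fps_coefM big_ord_recl /=.
rewrite f0 mul0r add0r big1 // => i _; rewrite IHk ?mulr0 //= /bump /=.
by rewrite ltn_subLR ?add1n ?ltn_ord // addSn (leq_trans nk) // ltnS leq_addl.
Qed.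

Definition fpsX : fps R := Fps (fun n => (n == 1)%:R).

(* (a; q)_oo.  When q has zero constant coefficient, the coefficient of index n
   of the partial products is constant from n + 1 factors on (qpochE). *)
Definition qpoch (a q : fps R) : fps R :=
  Fps (fun n => (\prod_(i < n.+1) (1 - a * q ^+ i)) n).

Lemma qpochE (a q : fps R) n m : q 0 = 0 -> (n < m)%N ->
  (\prod_(i < m) (1 - a * q ^+ i)) n = qpoch a q n.
Proof.
move=> q0; elim: m => // m IHm; rewrite ltnS leq_eqVlt => /predU1P[-> //|nm].
have -> : \prod_(i < m.+1) (1 - a * q ^+ i) =
    (\prod_(i < m) (1 - a * q ^+ i)) * (1 - a * q ^+ m) by rewrite big_ord_recr.
rewrite mulrBr mulr1 fps_coefD fps_coefN mulrA IHm //.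
rewrite (@fps_coefM_le _ _ 0) ?mulr0 ?subr0 // => i im.
by rewrite fps_coefX_lt // (leq_ltn_trans im).
Qed.

End Ring.

Section Inverse.
Variable R : comUnitRingType.
Implicit Types f g : fps R.

Definition fps_unit : {pred fps R} := fun f => f 0 \is a GRing.unit.

Definition fps_const (c : R) : fps R := Fps (fun n => c *+ (n == 0)).

(* 1 / f = c * \sum_k (1 - c * f)^k with c = 1 / f(0). *)
Definition fps_inv f : fps R :=
  if f \in fps_unit then
    let c := fps_const (f 0)^-1 in
    c * Fps (fun n => (\sum_(k < n.+1) (1 - c * f) ^+ k) n)
  else f.

Fact fps_mulVx : {in fps_unit, left_inverse 1 fps_inv *%R}.
Proof.
move=> f fU; rewrite /fps_inv fU; set c := fps_const _; set h := 1 - c * f.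
have h0 : h 0 = 0.
  by rewrite fps_coefD fps_coefN fps_coefM0 /= mulVr // subrr.
set s := Fps _; have sE n m : (n < m)%N -> (\sum_(k < m) h ^+ k) n = s n.
  elim: m => // m IHm; rewrite ltnS leq_eqVlt => /predU1P[-> //|nm].
  have -> : \sum_(k < m.+1) h ^+ k = \sum_(k < m) h ^+ k + h ^+ m.
    by rewrite big_ord_recr.
  by rewrite fps_coefD IHm // fps_coefX_lt // addr0.
apply: fpsP => n; rewrite mulrAC.
have -> : c * f = 1 - h by rewrite /h opprB addrC subrK.
rewrite (@fps_coefM_le _ _ _ (\sum_(k < n.+1) h ^+ k)); last first.
  by move=> i ni; rewrite sE.
rewrite -[in LHS]opprB mulNr -subrX1 opprB fps_coefD fps_coefN.
by rewrite fps_coefX_lt // subr0.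
Qed.

Fact fps_unitPl f g : g * f = 1 -> fps_unit f.
Proof.
move=> /(congr1 (fun h : fps R => h 0)); rewrite fps_coefM0 fps_coef1 eqxx => gf.
by apply/unitrPr; exists (g 0); rewrite mulrC.
Qed.

Fact fps_inv_out : {in [predC fps_unit], fps_inv =1 id}.
Proof. by move=> f; rewrite inE /= /fps_inv => /negPf ->. Qed.

HB.instance Definition _ := GRing.ComNzRing_hasMulInverse.Build (fps R)
  fps_mulVx fps_unitPl fps_inv_out.

End Inverse.

Definition overpartition_gf (t : nat) : fps int :=
  let q := fpsX int in
  qpoch (q ^+ 2) (q ^+ 2) ^+ t / qpoch q q ^+ (2 * t).

(* The number written \overline{p}_{-t}(n). *)
Definition pbar (t n : nat) : int := overpartition_gf t n.

Lemma qpochXX_unit : qpoch (fpsX int) (fpsX int) \is a GRing.unit.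
Proof.
rewrite [_ \is a _]unfold_in /= /fps_unit /= big_ord_recl big_ord0 mulr1.
by rewrite fps_coefD fps_coefN fps_coefM0 mul0r subr0.
Qed.

Lemma overpartition_gfE t :
  overpartition_gf t * qpoch (fpsX int) (fpsX int) ^+ (2 * t) =
  qpoch (fpsX int ^+ 2) (fpsX int ^+ 2) ^+ t.
Proof. by rewrite /overpartition_gf divrK // unitrX // qpochXX_unit. Qed.

(* Main.v *)
(* By Gauss, (q;q)^2 / (q^2;q^2) is the theta series
   F = 1 + 2 sum_{j>=1} (-1)^j q^(j^2), so the generating function is F^(-5).
   Squares are 0, 1 or 4 mod 8, so F = T + 2qb and T = c + 2q^4 d with b, c, d
   power series in q^8.  Multiplying F by its conjugates (under q -> -q,
   q -> iq, ...) gives a power series N in q^8 with constant term 1, and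
   F^(-5) = (N / F)^5 / N^5.  Dividing by N^5 preserves divisibility of all the
   coefficients in a residue class mod 8, so it suffices to expand the explicit
   polynomial (N / F)^5 modulo 8 and modulo 128. *)
Require Import Defs.
From mathcomp Require Import all_boot all_algebra.
From mathcomp Require Import zify ring.

Set Implicit Arguments.
Unset Strict Implicit.
Unset Printing Implicit Defensive.

Import GRing.Theory.
Local Open Scope ring_scope.

(** * A finite form of Gauss's theta identity *)

Section FiniteGauss.
Variable R : comNzRingType.
Implicit Types q : R.

(** The second product is (q;q)_n / (q;q)_(s+1), written without division so that [R] can be any
    commutative ring. *)
Definition gauss_rem q n s : R :=
  (-1) ^+ s.+1 * (\prod_(i < s) (1 + q * q ^+ i)) *
  (\prod_(s.+1 <= i < n) (1 - q * q ^+ i)) * q ^+ (s.+1 * n.+1).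

(* A finite form of Gauss's identity in the style of Shanks: the remainder
   terms have order at least n + 1 in q. *)
Lemma finite_gauss q n :
  \prod_(i < n) (1 - q * q ^+ i) + 2 * (\sum_(s < n) gauss_rem q n s) =
  \prod_(i < n) (1 + q * q ^+ i) *
    (1 + 2 * \sum_(j < n) (-1) ^+ j.+1 * q ^+ (j.+1 ^ 2)).
Proof.
elim: n => [|n IHn]; first by rewrite !big_ord0; ring.
(* K is the telescoping certificate of the recurrence in n. *)
pose K s := (-1) ^+ s.+1 * (\prod_(i < s) (1 + q * q ^+ i)) *
  (\prod_(s <= i < n) (1 - q * q ^+ i)) * q ^+ (s.+1 * n.+1).
have step s : (s < n)%N ->
    gauss_rem q n.+1 s = (1 + q * q ^+ n) * gauss_rem q n s + (K s.+1 - K s).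
  move=> sn; rewrite /gauss_rem /K big_ord_recr /= (big_nat_recr n) //=.
  rewrite (big_ltn sn).
  have -> : (s.+1 * n.+2 = s.+1 * n.+1 + s.+1)%N by lia.
  have -> : (s.+2 * n.+1 = s.+1 * n.+1 + n.+1)%N by lia.
  rewrite !exprD.
  by move: (q ^+ (s.+1 * n.+1)) => a; rewrite !exprS; ring.
have tel : \sum_(s < n) gauss_rem q n.+1 s =
    (1 + q * q ^+ n) * (\sum_(s < n) gauss_rem q n s) + (K n - K 0%N).
  have -> : K n - K 0%N = \sum_(s < n) (K s.+1 - K s).
    by rewrite -(telescope_sumr K (leq0n n)) big_mkord.
  by rewrite mulr_sumr -big_split /=; apply: eq_bigr => s _; apply: step.
rewrite big_ord_recr [in X in _ + X = _]big_ord_recr /= tel.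
rewrite [in RHS]big_ord_recr [X in _ * (1 + 2 * X)]big_ord_recr /=.
(* The boundary terms close the recurrence: [- 2 K 0] turns the new factor 1 - q^(n+1) into 1 +
   q^(n+1), and [K n] plus the new remainder is the new theta term times (-q;q)_(n+1). *)
have Kn : K n = (-1) ^+ n.+1 * (\prod_(i < n) (1 + q * q ^+ i))
    * q ^+ (n.+1 ^ 2).
  by rewrite /K big_geq // mulr1 -mulnn.
have K0 : K 0%N = - (\prod_(i < n) (1 - q * q ^+ i)) * (q * q ^+ n).
  by rewrite /K big_ord0 mul1n big_mkord !exprS expr0; ring.
have Un : gauss_rem q n.+1 n = K n * (q * q ^+ n).
  rewrite Kn /gauss_rem big_geq // mulr1.
  have -> : (n.+1 * n.+2 = n.+1 ^ 2 + n.+1)%N by lia.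
  by rewrite exprD (exprS q); ring.
rewrite Un K0 Kn.
move: IHn; set D := \prod_(i < n) (1 - _); set N := \prod_(i < n) (1 + _).
set S := \sum_(s < n) gauss_rem _ _ _; set A := \sum_(j < n) _ => IHn.
have -> : D = N * (1 + 2 * A) - 2 * S by rewrite -IHn; ring.
ring.
Qed.

End FiniteGauss.

(** * Monomials and power series in q^d *)

Section Coefficients.
Variable R : comNzRingType.
Implicit Types f g : fps R.
Local Notation X := (fpsX R).

Lemma coef_expXM k f n :
  (X ^+ k * f) n = if (n < k)%N then 0 else f (n - k)%N.
Proof.
elim: k n => [|k IHk] n; first by rewrite mul1r subn0.
rewrite exprS -mulrA fps_coefM; case: n => [|n].
  by rewrite big_ord_recl big_ord0 /= mul0r addr0.
rewrite 2!big_ord_recl big1 => [|i _]; last by rewrite /= mul0r.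
by rewrite /= mul0r add0r mul1r addr0 ltnS subSS -IHk subn1.
Qed.

Lemma coef_expX k n : (X ^+ k) n = (n == k)%:R.
Proof.
rewrite -[X ^+ k]mulr1 coef_expXM fps_coef1.
by case: ltnP => nk; [rewrite ltn_eqF | congr (_%:R); lia].
Qed.

Definition supported (d : nat) f := forall n, ~~ (d %| n)%N -> f n = 0.

Lemma supported0 d : supported d 0. Proof. by []. Qed.

Lemma supported1 d : supported d 1.
Proof. by case=> [|n]; rewrite ?dvdn0. Qed.

Lemma supportedN d f : supported d f -> supported d (- f).
Proof. by move=> fd n nd; rewrite fps_coefN fd ?oppr0. Qed.

Lemma supportedD d f g : supported d f -> supported d g -> supported d (f + g).
Proof. by move=> fd gd n nd; rewrite fps_coefD fd ?gd ?addr0. Qed.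

Lemma supportedM d f g : supported d f -> supported d g -> supported d (f * g).
Proof.
move=> fd gd n nd; rewrite fps_coefM big1 // => i _.
have [di|ndi] := boolP (d %| i)%N; last by rewrite fd ?mul0r.
rewrite gd ?mulr0 //; apply: contra nd => dni.
by rewrite -(subnKC (ltn_ord i : (i <= n)%N)) dvdn_add.
Qed.

Lemma supportedX d f k : supported d f -> supported d (f ^+ k).
Proof.
move=> fd; elim: k => [|k IHk]; first exact: supported1.
by rewrite exprS; apply: supportedM.
Qed.

Lemma supported_nat d m : supported d m%:R.
Proof.
elim: m => [|m IHm]; first exact: supported0.
by rewrite -natr1; apply: supportedD => //; apply: supported1.
Qed.

Lemma supported_expX d k : (d %| k)%N -> supported d (X ^+ k).
Proof. by move=> dk n; rewrite coef_expX; case: eqP => // ->; rewrite dk. Qed.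

Lemma supported_dvd d e f : (d %| e)%N -> supported e f -> supported d f.
Proof.
by move=> de fe n nd; rewrite fe //; apply: contra nd; apply: dvdn_trans.
Qed.

End Coefficients.

(** * Polynomial identities for the norm and the fifth power of the cofactor *)

Section Cofactor.
Variable R : comNzRingType.
Variables x b c d u v w z T t Y W : R.
Hypothesis tE : t = u + 4 * x ^+ 4 * v.
Hypothesis YE : Y = t + 4 * x ^+ 2 * b ^+ 2.
Hypothesis WE : W = w - 8 * x ^+ 4 * z.
Hypothesis T2 : T ^+ 2 = t.

(* With F = T + 2 x b, the factors T - 2 x b, Y and W are the successive
   conjugates: F (T - 2 x b) = t - 4 x^2 b^2, this times Y is w + 8 x^4 z, and
   W removes the last power of x not divisible by 8 (see cofactor_norm). *)
Lemma cofactor_mod8 : T = c + 2 * x ^+ 4 * d ->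
  exists e, ((T - 2 * x * b) * Y * W) ^+ 5 =
    w ^+ 5 * (c * u ^+ 7)
    + 2 * (x ^+ 4 * (w ^+ 5 * (d * u ^+ 7 + 14 * c * v * u ^+ 6)))
    + 4 * (x ^+ 2 * (w ^+ 5 * (5 * b ^+ 2 * c * u ^+ 6)))
    - 2 * (x * (w ^+ 5 * (5 * b * u ^+ 7))) + 8 * e.
Proof.
move=> TE.
(* In each expansion the witness is the sum of the binomial terms dropped, divided by the
   modulus. *)
have [e1 T5] : exists e, (T - 2 * x * b) ^+ 5 =
    T * t ^+ 2 - 10 * x * b * t ^+ 2 + 8 * e.
  exists (5 * T ^+ 3 * x ^+ 2 * b ^+ 2 - 10 * T ^+ 2 * x ^+ 3 * b ^+ 3
    + 10 * T * x ^+ 4 * b ^+ 4 - 4 * x ^+ 5 * b ^+ 5).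
  by rewrite -T2; ring.
have [e2 Y5] : exists e, Y ^+ 5 =
    t ^+ 5 + 20 * t ^+ 4 * x ^+ 2 * b ^+ 2 + 8 * e.
  exists (20 * t ^+ 3 * x ^+ 4 * b ^+ 4 + 80 * t ^+ 2 * x ^+ 6 * b ^+ 6
    + 160 * t * x ^+ 8 * b ^+ 8 + 128 * x ^+ 10 * b ^+ 10).
  by rewrite YE; ring.
have [e3 W5] : exists e, W ^+ 5 = w ^+ 5 + 8 * e.
  pose r := x ^+ 4 * z; exists (- 5 * w ^+ 4 * r + 80 * w ^+ 3 * r ^+ 2
    - 640 * w ^+ 2 * r ^+ 3 + 2560 * w * r ^+ 4 - 4096 * r ^+ 5).
  by rewrite WE /r; ring.
have [e4 t7] : exists e, t ^+ 7 = u ^+ 7 + 28 * x ^+ 4 * v * u ^+ 6 + 8 * e.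
  pose p := x ^+ 4 * v; exists (42 * p ^+ 2 * u ^+ 5 + 280 * p ^+ 3 * u ^+ 4
    + 1120 * p ^+ 4 * u ^+ 3 + 2688 * p ^+ 5 * u ^+ 2 + 3584 * p ^+ 6 * u
    + 2048 * p ^+ 7).
  by rewrite tE /p; ring.
(* Modulo 4 suffices, since t^6 occurs in [ayE] only with the coefficients 20 and 200. *)
have [e5 t6] : exists e, t ^+ 6 = u ^+ 6 + 4 * e.
  pose p := x ^+ 4 * v; exists (6 * p * u ^+ 5 + 60 * p ^+ 2 * u ^+ 4
    + 320 * p ^+ 3 * u ^+ 3 + 960 * p ^+ 4 * u ^+ 2 + 1536 * p ^+ 5 * u
    + 1024 * p ^+ 6).
  by rewrite tE /p; ring.
pose a := T * t ^+ 2 - 10 * x * b * t ^+ 2.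
pose y := t ^+ 5 + 20 * t ^+ 4 * x ^+ 2 * b ^+ 2.
have ayE : a * y = T * t ^+ 7 + 20 * x ^+ 2 * b ^+ 2 * (T * t ^+ 6)
    - 10 * x * b * t ^+ 7 - 200 * x ^+ 3 * b ^+ 3 * t ^+ 6.
  by rewrite /a /y; ring.
exists (e1 * Y ^+ 5 * W ^+ 5 + a * e2 * W ^+ 5 + a * y * e3 + w ^+ 5 *
  (7 * x ^+ 8 * d * v * u ^+ 6 + T * e4
   + 5 * x ^+ 2 * b ^+ 2 * (x ^+ 4 * d * u ^+ 6 + 2 * T * e5)
   - 35 * x ^+ 5 * b * v * u ^+ 6 - 10 * x * b * e4
   - 25 * x ^+ 3 * b ^+ 3 * t ^+ 6)).
rewrite !exprMn T5 Y5 W5 -/a -/y.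
have -> : (a + 8 * e1) * (y + 8 * e2) * (w ^+ 5 + 8 * e3) =
    w ^+ 5 * (a * y) + 8 * (e1 * (y + 8 * e2) * (w ^+ 5 + 8 * e3)
      + a * e2 * (w ^+ 5 + 8 * e3) + a * y * e3) by ring.
rewrite ayE t7 t6 TE; ring.
Qed.

(* Mod 128, only the terms in x^3 could contribute to the class 7 mod 8 (the
   others are even, or x times a series in x^4); their coefficient is
   -280 b^3 t^6 W^5, and t^6 W^5 = u^6 w^5 mod 16 because
   3 v w - 5 u z is even. *)
Lemma cofactor_mod128 : z = u * v - 2 * b ^+ 4 ->
    w = u ^+ 2 + 16 * x ^+ 8 * v ^+ 2 ->
  exists e, ((T - 2 * x * b) * Y * W) ^+ 5 =
    T * (t ^+ 2 + 40 * x ^+ 2 * b ^+ 2 * t + 80 * x ^+ 4 * b ^+ 4)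
      * Y ^+ 5 * W ^+ 5
    - x * ((10 * b * t ^+ 7
            + 3232 * x ^+ 4 * b ^+ 5 * t ^+ 5 + 5120 * x ^+ 8 * b ^+ 9 * t ^+ 3)
           * W ^+ 5)
    - x ^+ 3 * (280 * b ^+ 3 * u ^+ 6 * w ^+ 5) + 128 * e.
Proof.
move=> zE wE.
have T5 : (T - 2 * x * b) ^+ 5 =
    T * (t ^+ 2 + 40 * x ^+ 2 * b ^+ 2 * t + 80 * x ^+ 4 * b ^+ 4)
    - x * (10 * b * t ^+ 2 + 80 * x ^+ 2 * b ^+ 3 * t + 32 * x ^+ 4 * b ^+ 5).
  by rewrite -T2; ring.
(* Modulo 64 suffices: only the odd part of [T5], whose coefficients are even, gets multiplied by
   this expansion. *)
have [e1 Y5] : exists e, Y ^+ 5 = t ^+ 5 + 20 * x ^+ 2 * b ^+ 2 * t ^+ 4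
    + 160 * x ^+ 4 * b ^+ 4 * t ^+ 3 + 64 * e.
  exists (10 * x ^+ 6 * b ^+ 6 * t ^+ 2 + 20 * x ^+ 8 * b ^+ 8 * t
    + 16 * x ^+ 10 * b ^+ 10).
  by rewrite YE; ring.
(* Modulo 16 suffices, since 280 = 8 * 35. *)
have [e2 tW] : exists e, t ^+ 6 * W ^+ 5 = u ^+ 6 * w ^+ 5 + 16 * e.
  pose p := x ^+ 4 * v; pose r := x ^+ 4 * z.
  have [e3 t6] : exists e, t ^+ 6 = u ^+ 6 + 24 * u ^+ 5 * p + 16 * e.
    exists (15 * u ^+ 4 * p ^+ 2 + 80 * u ^+ 3 * p ^+ 3
      + 240 * u ^+ 2 * p ^+ 4 + 384 * u * p ^+ 5 + 256 * p ^+ 6).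
    by rewrite tE /p; ring.
  have [e4 W5] : exists e, W ^+ 5 = w ^+ 5 - 40 * w ^+ 4 * r + 16 * e.
    exists (40 * w ^+ 3 * r ^+ 2 - 320 * w ^+ 2 * r ^+ 3
      + 1280 * w * r ^+ 4 - 2048 * r ^+ 5).
    by rewrite WE /r; ring.
  exists (x ^+ 4 * u ^+ 5 * w ^+ 4
        * (- u ^+ 2 * v + 24 * x ^+ 8 * v ^+ 3 + 5 * u * b ^+ 4)
      - 60 * u ^+ 5 * p * w ^+ 4 * r + t ^+ 6 * e4
      + e3 * (w ^+ 5 - 40 * w ^+ 4 * r)).
  have vw : 3 * v * w - 5 * u * z =
      2 * (- u ^+ 2 * v + 24 * x ^+ 8 * v ^+ 3 + 5 * u * b ^+ 4).
    by rewrite wE zE; ring.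
  transitivity (u ^+ 6 * w ^+ 5
      + 8 * x ^+ 4 * u ^+ 5 * w ^+ 4 * (3 * v * w - 5 * u * z)
      + 16 * (- 60 * u ^+ 5 * p * w ^+ 4 * r + t ^+ 6 * e4
      + e3 * (w ^+ 5 - 40 * w ^+ 4 * r))).
    by rewrite W5 t6 /p /r; ring.
  by rewrite vw; ring.
(* The x^7 term, which could also reach the class 7, has coefficient 80 * 160 + 32 * 20 = 128 * 105
   and joins the error. *)
exists (- x * W ^+ 5 * (5 * b * t ^+ 2 * e1 + 40 * x ^+ 2 * b ^+ 3 * t * e1
    + 16 * x ^+ 4 * b ^+ 5 * e1 + 105 * x ^+ 6 * b ^+ 7 * t ^+ 4)
  - 35 * x ^+ 3 * b ^+ 3 * e2).
rewrite !exprMn T5.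
transitivity (T * (t ^+ 2 + 40 * x ^+ 2 * b ^+ 2 * t + 80 * x ^+ 4 * b ^+ 4)
      * Y ^+ 5 * W ^+ 5
    - x * ((10 * b * t ^+ 7
            + 3232 * x ^+ 4 * b ^+ 5 * t ^+ 5 + 5120 * x ^+ 8 * b ^+ 9 * t ^+ 3)
           * W ^+ 5)
    - 280 * x ^+ 3 * b ^+ 3 * (t ^+ 6 * W ^+ 5)
    - 128 * x * W ^+ 5 * (5 * b * t ^+ 2 * e1 + 40 * x ^+ 2 * b ^+ 3 * t * e1
    + 16 * x ^+ 4 * b ^+ 5 * e1 + 105 * x ^+ 6 * b ^+ 7 * t ^+ 4)).
  by rewrite Y5; ring.
by rewrite tW; ring.
Qed.

(** Three differences of squares in turn. The values of [z] and [w] come from t^2 - 16 x^4 b^4 = w +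
    8 x^4 z. *)
Lemma cofactor_norm : z = u * v - 2 * b ^+ 4 ->
    w = u ^+ 2 + 16 * x ^+ 8 * v ^+ 2 ->
  (T + 2 * x * b) * ((T - 2 * x * b) * Y * W) =
    w ^+ 2 - 64 * x ^+ 8 * z ^+ 2.
Proof.
move=> zE wE.
have tY : (t - 4 * x ^+ 2 * b ^+ 2) * Y = w + 8 * x ^+ 4 * z.
  by rewrite YE tE wE zE; ring.
transitivity ((T ^+ 2 - 4 * x ^+ 2 * b ^+ 2) * Y * W); first by ring.
by rewrite T2 tY WE; ring.
Qed.

End Cofactor.

(** * Gauss's identity for formal power series *)

Section Theta.
Variable R : comNzRingType.
Local Notation X := (fpsX R).
Implicit Types f : fps R.

Lemma fps_coefM_eq (f1 f2 g1 g2 : fps R) n :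
    (forall i, (i <= n)%N -> f1 i = f2 i) ->
    (forall i, (i <= n)%N -> g1 i = g2 i) ->
  (f1 * g1) n = (f2 * g2) n.
Proof.
move=> f12 g12; rewrite (fps_coefM_le f1 g12) mulrC.
by rewrite (fps_coefM_le g2 f12) mulrC.
Qed.

(** Factorwise, 1 - q^(2i+2) = (1 - q^(i+1)) (1 + q^(i+1)). *)
Lemma qpoch_sqr : qpoch (X ^+ 2) (X ^+ 2) = qpoch X X * qpoch (- X) X.
Proof.
apply: fpsP => n; rewrite -(@qpochE _ _ _ n n.+1) //; last first.
  by rewrite coef_expX.
have -> : \prod_(i < n.+1) (1 - X ^+ 2 * (X ^+ 2) ^+ i) =
    \prod_(i < n.+1) (1 - X * X ^+ i) * \prod_(i < n.+1) (1 - - X * X ^+ i).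
  rewrite -big_split; apply: eq_bigr => i _ /=.
  by rewrite -exprM mulnC exprM; ring.
by apply: fps_coefM_eq => i ni; apply: qpochE.
Qed.

(** Terms with j >= n have exponent (j+1)^2 > n, so the truncated sum already gives the final
    coefficient of q^n. *)
Definition theta_half : fps R :=
  Fps (fun n => (\sum_(j < n) (-1) ^+ j.+1 * X ^+ (j.+1 ^ 2)) n).

Definition theta : fps R := 1 + 2 * theta_half.

Lemma coef_sign_expX k m n :
  n != m -> ((-1) ^+ k * X ^+ m : fps R) n = 0.
Proof.
move=> nm; rewrite mulrC coef_expXM; case: ltnP => // mn.
(* Only 0 is a multiple of 0, so this says that the sign is a constant series. *)
have s0 : supported 0 ((-1) ^+ k : fps R).
  by apply/supportedX/supportedN/supported1.
by rewrite s0 // dvd0n subn_eq0 -ltnNge ltn_neqAle eq_sym nm.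
Qed.

Lemma theta_halfE n m : (n <= m)%N ->
  (\sum_(j < m) (-1) ^+ j.+1 * X ^+ (j.+1 ^ 2)) n = theta_half n.
Proof.
elim: m => [|m IHm]; first by rewrite leqn0 => /eqP->.
rewrite leq_eqVlt => /predU1P[-> //|nm].
have -> : \sum_(j < m.+1) (-1) ^+ j.+1 * X ^+ (j.+1 ^ 2) =
    \sum_(j < m) (-1) ^+ j.+1 * X ^+ (j.+1 ^ 2)
    + (-1) ^+ m.+1 * X ^+ (m.+1 ^ 2) by rewrite big_ord_recr.
by rewrite fps_coefD IHm // coef_sign_expX ?addr0 //; nia.
Qed.

Lemma theta_half0 : theta_half 0%N = 0.
Proof. by rewrite -(@theta_halfE 0 0) // big_ord0. Qed.

Lemma theta_half_nonsquare n :
  (forall j, (j ^ 2)%N <> n) -> theta_half n = 0.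
Proof.
move=> nsq; rewrite -(@theta_halfE n n) // fps_coef_sum big1 // => j _.
by apply: coef_sign_expX; apply/eqP => nE; apply: (nsq j.+1).
Qed.

Lemma gauss_theta : qpoch X X = qpoch (- X) X * theta.
Proof.
apply: fpsP => n.
have /(congr1 (fun f : fps R => f n)) := finite_gauss X n.+1.
have -> : \prod_(i < n.+1) (1 + X * X ^+ i) =
    \prod_(i < n.+1) (1 - - X * X ^+ i).
  by apply: eq_bigr => i _; rewrite mulNr opprK.
(* With n + 1 factors, every remainder has order at least n + 2 and does not reach the coefficient
   of q^n. *)
rewrite fps_coefD qpochE // mulr_sumr fps_coef_sum big1 ?addr0; last first.
  move=> s _; rewrite mulrA mulrC coef_expXM.
  by have -> : (n < s.+1 * n.+2)%N by nia.
move=> ->; apply: fps_coefM_eq => i ni; first by apply: qpochE.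
rewrite !fps_coefD; congr (_ + _).
by apply: fps_coefM_le => j ji; apply: theta_halfE; lia.
Qed.

End Theta.

(** * Divisibility in residue classes and the dissection of theta modulo 8 *)

Section Overpartitions.
Local Notation X := (fpsX int).
Implicit Types f g : fps int.

(** Since (q;q)^2 = (q^2;q^2) theta, the invertible factor (q^2;q^2)^t cancels from the defining
    relation. *)
Lemma overpartition_gf_theta t : overpartition_gf t * theta int ^+ t = 1.
Proof.
have Qu : qpoch (X ^+ 2) (X ^+ 2) \is a GRing.unit.
  rewrite [_ \is a _]unfold_in /= /fps_unit qpoch_sqr fps_coefM0.
  rewrite -!(@qpochE _ _ _ 0 1) // !big_ord1.
  rewrite !(fps_coefD, fps_coefN, fps_coefM0).
  by rewrite /= !(mul0r, oppr0).
have pE : qpoch X X ^+ 2 = qpoch (X ^+ 2) (X ^+ 2) * theta int.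
  by rewrite qpoch_sqr -mulrA -gauss_theta.
move: (overpartition_gfE t) pE Qu.
move: (qpoch (X ^+ 2) _) (qpoch X X) (overpartition_gf t) (theta int).
move=> Q p g h gE pE Qu; apply: (mulIr (unitrX t Qu)).
by rewrite mul1r -mulrA -exprMn [h * Q]mulrC -pE -exprM.
Qed.

Lemma coef_natM m f n : (m%:R * f) n = m%:R * f n.
Proof.
rewrite !mulr_natl; elim: m => // m IHm.
by rewrite !mulrS fps_coefD IHm.
Qed.

Lemma coef0_exp f k : (f ^+ k) 0%N = f 0%N ^+ k.
Proof. by elim: k => // k IHk; rewrite !exprS fps_coefM0 IHk. Qed.

Definition dvd_class (m d r : nat) f :=
  forall n, (m %| f (d * n + r)%N)%Z.

Lemma dvd_classD m d r f g :
  dvd_class m d r f -> dvd_class m d r g -> dvd_class m d r (f + g).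
Proof. by move=> mf mg n; rewrite fps_coefD rpredD. Qed.

Lemma dvd_classN m d r f : dvd_class m d r f -> dvd_class m d r (- f).
Proof. by move=> mf n; rewrite fps_coefN rpredN. Qed.

Lemma dvd_class_natM m k d r f : (m %| k)%N -> dvd_class m d r (k%:R * f).
Proof. by move=> mk n; rewrite coef_natM natz dvdz_mulr. Qed.

Lemma dvd_classMn m k d r f : dvd_class m d r f -> dvd_class m d r (k%:R * f).
Proof. by move=> mf n; rewrite coef_natM dvdz_mull. Qed.

(** The exponents of q^k f all lie in the class k mod e, so the coefficients concerned are zero,
    whatever [m] is. *)
Lemma dvd_class_expXM m e d r k f : (e %| d)%N -> supported e f ->
  k != r %[mod e] -> dvd_class m d r (X ^+ k * f).
Proof.
move=> /dvdnP[j ->] fe kr n; rewrite coef_expXM; case: ltnP => // kn.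
rewrite fe ?dvdz0 // -eqn_mod_dvd // mulnAC modnMDl.
by rewrite eq_sym.
Qed.

Lemma dvd_class_term m e d r j k f : (e %| d)%N -> supported e f ->
  (m %| k)%N || (j != r %[mod e]) -> dvd_class m d r (k%:R * (X ^+ j * f)).
Proof.
move=> ed fe /orP[mk|jr]; first exact: dvd_class_natM.
by apply: dvd_classMn; apply: dvd_class_expXM fe jr.
Qed.

(** Strong induction: as f is a series in q^d with constant term 1, the coefficient of gf at dn + r
    is that of g plus multiples of earlier coefficients of g in the same class. *)
Lemma dvd_class_cancel m d r f g : (r < d)%N -> supported d f -> f 0%N = 1 ->
  dvd_class m d r (g * f) -> dvd_class m d r g.
Proof.
move=> rd fd f0 mgf n; elim/ltn_ind: n => n IHn.
have := mgf n; rewrite mulrC fps_coefM big_ord_recl f0 mul1r subn0.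
rewrite rpredDr //; apply: rpred_sum => -[i /= ilt] _.
rewrite /bump add1n; have [/dvdnP[k ik]|ndi] := boolP (d %| i.+1)%N; last first.
  by rewrite fd // mul0r rpred0.
have kn : (k <= n)%N.
  by rewrite -ltnS -(ltn_pmul2l (leq_ltn_trans (leq0n r) rd)); lia.
apply: dvdz_mull.
have -> : (d * n + r - i.+1 = d * (n - k) + r)%N by nia.
by apply: IHn; nia.
Qed.

(** The factor q^r is divided out, so that the result is a series in q^8. *)
Definition section8 r f : fps int :=
  Fps (fun n => if (8 %| n)%N then f (n + r)%N else 0).

Lemma section8_supported r f : supported 8 (section8 r f).
Proof. by move=> n /negPf /= ->. Qed.

Lemma coef_section8 r f n : (r < 8)%N ->
  (X ^+ r * section8 r f) n = if (n %% 8 == r)%N then f n else 0.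
Proof.
move=> r8; rewrite coef_expXM; case: ltnP => nr.
  by rewrite modn_small ?(ltn_trans nr) // ltn_eqF.
by rewrite /= -eqn_mod_dvd // (modn_small r8) subnK.
Qed.

Lemma theta_dissection :
  theta int = 1 + 2 * section8 0 (theta_half int)
    + 2 * X ^+ 4 * section8 4 (theta_half int)
    + 2 * X * section8 1 (theta_half int).
Proof.
suff thE : theta_half int = X ^+ 0 * section8 0 (theta_half int)
    + X ^+ 4 * section8 4 (theta_half int)
    + X ^+ 1 * section8 1 (theta_half int).
  rewrite /theta {1}thE; move: (section8 0 _) (section8 4 _) (section8 1 _).
  by move=> a b c; ring.
apply: fpsP => n; rewrite !fps_coefD !coef_section8 //.
case: eqVneq => [->|n0]; first by rewrite !addr0.
case: eqVneq => [->|n4]; first by rewrite add0r addr0.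
rewrite !add0r; case: eqVneq => // n1.
apply: theta_half_nonsquare => j jn; move: n0 n4 n1.
rewrite -jn -modnXm; have := ltn_pmod j (isT : 0 < 8)%N.
by case: (j %% 8)%N => [|[|[|[|[|[|[|[|]]]]]]]].
Qed.

End Overpartitions.

(** * Congruences for the inverse fifth power and for overpartitions *)

Ltac supported :=
  repeat first [assumption | apply: supported_nat | apply: supported1
    | (apply: supported_expX; done) | apply: supportedX | apply: supportedN
    | apply: supportedD | apply: supportedM].

Lemma dvd_inverse_fifth_power (g c d b : fps int) :
  supported 8 c -> supported 8 d -> supported 8 b -> c 0%N = 1 ->
  g * (c + 2 * fpsX int ^+ 4 * d + 2 * fpsX int * b) ^+ 5 = 1 ->
  dvd_class 2 8 1 g /\ dvd_class 4 8 2 g /\ dvd_class 8 8 3 g /\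
  dvd_class 2 8 4 g /\ dvd_class 8 8 5 g /\ dvd_class 8 8 6 g /\
  dvd_class 128 8 7 g.
Proof.
set x := fpsX int => cS dS bS c0 gF.
pose T := c + 2 * x ^+ 4 * d.
pose u := c ^+ 2 + 4 * x ^+ 8 * d ^+ 2; pose v := c * d.
pose t := u + 4 * x ^+ 4 * v; pose Y := t + 4 * x ^+ 2 * b ^+ 2.
pose z := u * v - 2 * b ^+ 4; pose w := u ^+ 2 + 16 * x ^+ 8 * v ^+ 2.
pose W := w - 8 * x ^+ 4 * z.
have T2 : T ^+ 2 = t by rewrite /T /t /u /v; ring.
have uS : supported 8 u by rewrite /u; supported.
have vS : supported 8 v by rewrite /v; supported.
have zS : supported 8 z by rewrite /z; supported.
have wS : supported 8 w by rewrite /w; supported.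
pose N := w ^+ 2 - 64 * x ^+ 8 * z ^+ 2.
have NS : supported 8 (N ^+ 5) by rewrite /N; supported.
have N0 : (N ^+ 5) 0%N = 1.
  rewrite /N /w /u !(coef0_exp, fps_coefD, fps_coefN, fps_coefM0) c0 /=.
  by rewrite !(expr0n, mulr0, mul0r, addr0, oppr0, expr1n).
pose P := ((T - 2 * x * b) * Y * W) ^+ 5.
have gfN : g * N ^+ 5 = P.
  rewrite /N -(@cofactor_norm _ x b u v w z T t Y W) // exprMn mulrA.
  by rewrite gF mul1r.
have red m r : (r < 8)%N -> dvd_class m 8 r P -> dvd_class m 8 r g.
  by move=> r8 mP; apply: (dvd_class_cancel r8 NS N0); rewrite gfN.
have [e8 P8] := @cofactor_mod8 _ x b c d u v w z T t Y W
  erefl erefl erefl T2 erefl.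
have [e128 P128] := @cofactor_mod128 _ x b u v w z T t Y W
  erefl erefl erefl T2 erefl erefl.
(* Modulo 8, [P] has terms x^0, 2 x^4, 4 x^2 and 2 x times series in x^8; each condition ensures
   that one of them vanishes modulo m or misses the class r. *)
have small m r : (m %| 8)%N -> (0 < r < 8)%N -> (m %| 2)%N || (r != 4)%N ->
    (m %| 4)%N || (r != 2)%N -> (m %| 2)%N || (r != 1)%N ->
    dvd_class m 8 r g.
  move=> m8 /andP[r0 r8] r4 r2 r1; apply: red => //; rewrite /P P8.
  apply: dvd_classD; last exact: dvd_class_natM.
  apply: dvd_classD; last apply: dvd_classN.
    apply: dvd_classD; first apply: dvd_classD.
    - rewrite -[w ^+ 5 * _]mul1r -(expr0 x).
      apply: (@dvd_class_expXM _ 8) => //; first by supported.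
      by rewrite mod0n modn_small // eq_sym -lt0n.
    - apply: (@dvd_class_term _ 8) => //; first by supported.
      by rewrite (modn_small r8) eq_sym.
    - apply: (@dvd_class_term _ 8) => //; first by supported.
      by rewrite (modn_small r8) eq_sym.
  apply: (@dvd_class_term _ 8 _ _ 1) => //; first by supported.
  by rewrite (modn_small r8) eq_sym.
do 6![apply: conj; first exact: small].
apply: red => //; rewrite /P P128.
have S4 (f : fps int) : supported 8 f -> supported 4 f by apply: supported_dvd.
have bS4 := S4 _ bS; have uS4 := S4 _ uS; have vS4 := S4 _ vS.
have zS4 := S4 _ zS; have wS4 := S4 _ wS.
have cS4 := S4 _ cS; have dS4 := S4 _ dS.
have TS : supported 4 T by rewrite /T; supported.
have tS : supported 4 t by rewrite /t; supported.
have WS : supported 4 W by rewrite /W; supported.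
have S2 (f : fps int) : supported 4 f -> supported 2 f by apply: supported_dvd.
have bS2 := S2 _ bS4; have TS2 := S2 _ TS.
have tS2 := S2 _ tS; have WS2 := S2 _ WS.
have YS : supported 2 Y by rewrite /Y; supported.
(* The three remaining terms avoid the class 7: a series in x^2, x times a series in x^4, and x^3
   times a series in x^8. *)
apply: dvd_classD; last exact: dvd_class_natM.
apply: dvd_classD; last apply: dvd_classN.
  apply: dvd_classD; last apply: dvd_classN.
    rewrite -[T * _ * _ * _]mul1r -(expr0 x).
    by apply: (@dvd_class_expXM _ 2) => //; supported.
  by apply: (@dvd_class_expXM _ 4 _ _ 1) => //; supported.
by apply: (@dvd_class_expXM _ 8) => //; supported.
Qed.

Theorem theorem1p1 (n : nat) :
  (pbar 5 (8 * n + 1) = 0 %[mod 2])%Z /\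
  (pbar 5 (8 * n + 2) = 0 %[mod 4])%Z /\
  (pbar 5 (8 * n + 3) = 0 %[mod 8])%Z /\
  (pbar 5 (8 * n + 4) = 0 %[mod 2])%Z /\
  (pbar 5 (8 * n + 5) = 0 %[mod 8])%Z /\
  (pbar 5 (8 * n + 6) = 0 %[mod 8])%Z /\
  (pbar 5 (8 * n + 7) = 0 %[mod 128])%Z.
Proof.
have modE m r : dvd_class m 8 r (overpartition_gf 5) ->
    (pbar 5 (8 * n + r) = 0 %[mod m])%Z.
  by move=> /(_ n) mn; apply/eqP; rewrite eqz_mod_dvd subr0.
have gF := overpartition_gf_theta 5; rewrite theta_dissection in gF.
have s8 := section8_supported.
have cS : supported 8 (1 + 2 * section8 0 (theta_half int)).
  by supported; apply: s8.
have c0 : (1 + 2 * section8 0 (theta_half int)) 0%N = 1.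
  have s0 : section8 0 (theta_half int) 0%N = 0 := theta_half0 int.
  by rewrite fps_coefD coef_natM s0.
have [c1 [c2 [c3 [c4 [c5 [c6 c7]]]]]] :=
  dvd_inverse_fifth_power cS (s8 4%N _) (s8 1%N _) c0 gF.
by do 6![apply: conj; first exact: modE]; apply: modE.
Qed.
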